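(* For any admissibly ordered orthoplicial Platonic configuration $\mathscr{V}$, its $F$-matrix $\boldsymbol{F}=\boldsymbol{F}(\mathscr{V})$ satisfies $$\boldsymbol{F}^{T}\boldsymbol{Q}_F\,\boldsymbol{F}=\boldsymbol{Q}_W .$$ In particular, writing $\boldsymbol{a},\boldsymbol{b},\hat{\boldsymbol{x}},\hat{\boldsymbol{y}},\hat{\boldsymbol{z}}$ for the 1st, 2nd, 3rd, 4th, 5th column vectors of $\boldsymbol{F}$, we have $$F(\boldsymbol{a})=0,\quad F(\boldsymbol{b})=0,\quad F(\hat{\boldsymbol{x}})=2,\quad F(\hat{\boldsymbol{y}})=2,\quad F(\hat{\boldsymbol{z}})=2 .$$
   Context: Work in $\hat{\mathbb{R}}^3=\mathbb{R}^3\cup\{\infty\}$. A ''sphere'' $S$ means a Euclidean sphere, or a plane (with $\infty$ added), together with a choice of orienting region $B$, one of the two components of its complement. Its inversive coordinate vector $\boldsymbol{v}(S)=(a,b,\hat x,\hat y,\hat z)$ (a row vector) is: for a Euclidean sphere with center $\boldsymbol{c}$ and oriented radius $r$ ($r>0$ if $B$ is the ball, $r<0$ if $B$ is the exterior), $b=1/r$ (the bend), $a=b|\boldsymbol{c}|^2-1/b$, and $(\hat x,\hat y,\hat z)=b\,\boldsymbol{c}$; for a plane $\{\boldsymbol{n}\cdot\boldsymbol{x}=h\}$ with $\boldsymbol{n}$ the unit normal pointing into $B$, $\boldsymbol{v}(S)=(2h,0,n_x,n_y,n_z)$. Möbius transformations of $\hat{\mathbb{R}}^3$ (all conformal and anti-conformal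 transformations) act on oriented spheres by mapping $(S,B)$ to its image. The standard configuration $\mathscr{V}_0=(S_1,\dots,S_8)$ consists of the spheres with inversive coordinates $(2,0,0,0,1)$, $(2,0,0,0,-1)$, $(1,1,\sqrt2,0,0)$, $(1,1,0,\sqrt2,0)$, $(0,2,0,0,-1)$, $(0,2,0,0,1)$, $(1,1,-\sqrt2,0,0)$, $(1,1,0,-\sqrt2,0)$, in this order. An orthoplicial Platonic configuration is the image of $\mathscr{V}_0$ under a Möbius transformation. An ordering $S_1,\dots,S_8$ of its spheres is admissible if distinct $S_i,S_j$ are tangent when $i\not\equiv j\pmod 4$ and disjoint when $i\equiv j\pmod 4$. For an admissibly ordered configuration put $\boldsymbol{v}_k=\boldsymbol{v}(S_k)$ and $\boldsymbol{v}_\mu=\tfrac12(\boldsymbol{v}_1+\boldsymbol{v}_5)$ (the antipodal vector). Its $F$-matrix is the $5\times5$ matrix with rows $\boldsymbol{v}_1,\boldsymbol{v}_2,\boldsymbol{v}_3,\boldsymbol{v}_4,\boldsymbol{v}_\mu$. Matrices: $$\boldsymbol{Q}_F=\begin{pmatrix}1&0&0&0&-1\\0&1&0&0&-1\\0&0&1&0&-1\\0&0&0&1&-1\\-1&-1&-1&-1&2\end{pmatrix},\qquad \boldsymbol{Q}_W=\begin{pmatrix}0&-4&0&0&0\\-4&0&0&0&0\\0&0&2&0&0\\0&0&0&2&0\\0&0&0&0&2\end{pmatrix}.$$ The orthoplicial Descartes form is $F(\boldsymbol{\zeta})=\boldsymbol{\zeta}^T\boldsymbol{Q}_F\boldsymbol{\zeta}=2\zeta_\mu^2-2\zeta_\mu(\zeta_1+\zeta_2+\zeta_3+\zeta_4)+(\zeta_1^2+\zeta_2^2+\zeta_3^2+\zeta_4^2)$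 for $\boldsymbol{\zeta}=(\zeta_1,\zeta_2,\zeta_3,\zeta_4,\zeta_\mu)^T$. *)

(* Defs.v *)
From HB Require Import structures.
From mathcomp Require Import all_boot all_order all_algebra all_fingroup.
From mathcomp Require Import ring.
From mathcomp Require Import all_classical all_reals all_analysis.
Set Implicit Arguments.
Unset Strict Implicit.
Unset Printing Implicit Defensive.
Import Order.TTheory GRing.Theory Num.Theory.
Import numFieldNormedType.Exports.
Local Open Scope classical_set_scope.
Local Open Scope ring_scope.

(* The extended space: [None] is the point at infinity. *)
Definition Rhat (R : realType) : Type := one_point_compactification 'rV[R]_3.

Definition dot (R : realType) (u v : 'rV[R]_3) : R := (u *m v^T) 0 0.

(* [Sphere c r _] has centre [c] and oriented radius [r];
   [Plane n h _] is {n . x = h} with [n] pointing into the orienting region. *)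
Inductive osphere (R : realType) : Type :=
| Sphere (c : 'rV[R]_3) (r : R) of r != 0
| Plane (n : 'rV[R]_3) (h : R) of dot n n = 1.

Definition carrier (R : realType) (S : osphere R) : set (Rhat R) :=
  match S with
  | Sphere c r _ =>
      [set p | if p is Some x then dot (x - c) (x - c) = r ^+ 2 else False]
  | Plane n h _ =>
      [set p | if p is Some x then dot n x = h else True]
  end.

Definition region (R : realType) (S : osphere R) : set (Rhat R) :=
  match S with
  | Sphere c r _ =>
      [set p | if p is Some x
               then if 0 < r then dot (x - c) (x - c) < r ^+ 2
                    else r ^+ 2 < dot (x - c) (x - c)
               else r < 0]
  | Plane n h _ =>
      [set p | if p is Some x then h < dot n x else False]
  end.

Definition row5 (R : realType) (a b x y z : R) : 'rV[R]_5 :=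
  \row_j [:: a; b; x; y; z]`_j.

Definition inv_coords (R : realType) (S : osphere R) : 'rV[R]_5 :=
  match S with
  | Sphere c r _ =>
      let b := r^-1 in
      row5 (b * dot c c - b^-1) b
           (b * c 0 0) (b * c 0 1) (b * c 0 2)
  | Plane n h _ => row5 (2 * h) 0 (n 0 0) (n 0 1) (n 0 2)
  end.

(* Moebius transformations are the conformal and the anti-conformal
   self-bijections of [Rhat R]. Near infinity, conformality is read in the chart
   [flip], the inversion in the unit sphere followed by a reflection; this is an
   orientation-preserving involution exchanging 0 and infinity. *)
Definition flip (R : realType) (p : Rhat R) : Rhat R :=
  if p is Some x then
    if x == 0 then None
    else Some ((dot x x)^-1 *: \row_j (if j == 2 then - x 0 j else x 0 j))
  else Some 0.

Definition chart (R : realType) (p : Rhat R) : Rhat R -> Rhat R :=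
  if p is Some _ then id else @flip R.

(* The value at infinity is junk. *)
Definition finpart (R : realType) (p : Rhat R) : 'rV[R]_3 :=
  if p is Some x then x else 0.

(* An injective [f] takes the value sent to junk at one point only, so
   differentiability of [local_rep f p] at [local_pt p] is not affected. *)
Definition local_rep (R : realType) (f : Rhat R -> Rhat R) (p : Rhat R) :
    'rV[R]_3 -> 'rV[R]_3 :=
  fun x => finpart (chart (f p) (f (chart p (Some x)))).

Definition local_pt (R : realType) (p : Rhat R) : 'rV[R]_3 :=
  finpart (chart p p).

Definition angle_preserving_at (R : realType) (f : Rhat R -> Rhat R)
    (p : Rhat R) : Prop :=
  differentiable (local_rep f p) (local_pt p) /\
  exists2 c : R, 0 < c &
    jacobian (local_rep f p) (local_pt p) *m
      (jacobian (local_rep f p) (local_pt p))^T = c%:M.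

Definition conformal (R : realType) (f : Rhat R -> Rhat R) : Prop :=
  forall p, angle_preserving_at f p /\
    0 < \det (jacobian (local_rep f p) (local_pt p)).

Definition anticonformal (R : realType) (f : Rhat R -> Rhat R) : Prop :=
  forall p, angle_preserving_at f p /\
    \det (jacobian (local_rep f p) (local_pt p)) < 0.

Definition moebius (R : realType) (f : Rhat R -> Rhat R) : Prop :=
  bijective f /\ (conformal f \/ anticonformal f).

Definition maps_osphere (R : realType) (f : Rhat R -> Rhat R)
    (S T : osphere R) : Prop :=
  carrier T = f @` carrier S /\ region T = f @` region S.

Definition std_coords (R : realType) (i : 'I_8) : 'rV[R]_5 :=
  let s := Num.sqrt 2 in
  nth 0 [:: row5 2 0 0 0 1; row5 2 0 0 0 (-1);
            row5 1 1 s 0 0; row5 1 1 0 s 0;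
            row5 0 2 0 0 (-1); row5 0 2 0 0 1;
            row5 1 1 (- s) 0 0; row5 1 1 0 (- s) 0] i.

Definition standard_configuration (R : realType)
    (V : 'I_8 -> osphere R) : Prop :=
  forall i, inv_coords (V i) = std_coords R i.

(* The permutation makes [V] an arbitrary ordering of the image spheres. *)
Definition orthoplicial_platonic (R : realType)
    (V : 'I_8 -> osphere R) : Prop :=
  exists (V0 : 'I_8 -> osphere R) (f : Rhat R -> Rhat R) (s : 'S_8),
    [/\ standard_configuration V0, moebius f &
        forall i, maps_osphere f (V0 (s i)) (V i)].

Definition tangent (R : realType) (S T : osphere R) : Prop :=
  exists p, carrier S `&` carrier T = [set p].

Definition disjoint_spheres (R : realType) (S T : osphere R) : Prop :=
  carrier S `&` carrier T = set0.

Definition admissible (R : realType) (V : 'I_8 -> osphere R) : Prop :=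
  forall i j : 'I_8, i != j ->
    if i == j %[mod 4] then disjoint_spheres (V i) (V j)
    else tangent (V i) (V j).

(* Indices start at 0, so the spheres 1 and 5 are [V 0] and [V 4]. *)
Definition antipodal_vector (R : realType) (V : 'I_8 -> osphere R) : 'rV[R]_5 :=
  2^-1 *: (inv_coords (V (inord 0)) + inv_coords (V (inord 4))).

Definition F_matrix (R : realType) (V : 'I_8 -> osphere R) : 'M[R]_5 :=
  \matrix_(i < 5)
    if (i < 4)%N then inv_coords (V (inord i)) else antipodal_vector V.

Definition mx5 (R : realType) (rows : seq (seq R)) : 'M[R]_5 :=
  \matrix_(i < 5, j < 5) (nth [::] rows i)`_j.

Definition Q_F (R : realType) : 'M[R]_5 :=
  mx5 [:: [:: 1; 0; 0; 0; -1];
          [:: 0; 1; 0; 0; -1];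
          [:: 0; 0; 1; 0; -1];
          [:: 0; 0; 0; 1; -1];
          [:: -1; -1; -1; -1; 2]].

Definition Q_W (R : realType) : 'M[R]_5 :=
  mx5 [:: [:: 0; -4; 0; 0; 0];
          [:: -4; 0; 0; 0; 0];
          [:: 0; 0; 2; 0; 0];
          [:: 0; 0; 0; 2; 0];
          [:: 0; 0; 0; 0; 2]].

Definition descartes_form (R : realType) (zeta : 'cV[R]_5) : R :=
  (zeta^T *m Q_F R *m zeta) 0 0.

Lemma descartes_formE (R : realType) (zeta : 'cV[R]_5) :
  descartes_form zeta =
    let z i := zeta (inord i) 0 in
    2 * z 4 ^+ 2 - 2 * z 4 * (z 0 + z 1 + z 2 + z 3)
      + (z 0 ^+ 2 + z 1 ^+ 2 + z 2 ^+ 2 + z 3 ^+ 2).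
Proof.
rewrite /descartes_form /= mxE !big_ord_recl big_ord0 !mxE.
rewrite !big_ord_recl !big_ord0 !mxE /=.
have E (i : 'I_5) (k : nat) : i = k :> nat -> zeta i 0 = zeta (inord k) 0.
  by move=> <-; rewrite inord_val.
rewrite (E ord0 0%N) // !(E (lift ord0 _) _ (erefl _)) /= /bump /=; ring.
Qed.

(* Main.v *)
(* The bijection carries the disjoint orienting regions of the standard
   configuration to disjoint regions. For the Lorentz form [ip], normalised so
   that inversive coordinate vectors have square 1, disjoint regions force
   [ip <= -1], while a common point of the spheres forces [ip >= -1]; hence
   tangent spheres have product -1. These products determine those of the
   opposite pairs: the differences [v k - v (k + 4)] are four mutually
   orthogonal spacelike vectors of the 5-dimensional Lorentz space, and the
   sums [v k + v (k + 4)] all lie on the line orthogonal to them and have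
   pairwise products -4, so they coincide.
   This determines the Gram matrix of the rows of the F-matrix, which is twice
   the inverse of [Q_F]; inverting the Gram identity gives the theorem. *)
Require Import Defs.
From mathcomp Require Import all_boot all_order all_algebra all_fingroup.
From mathcomp Require Import all_classical all_reals all_analysis.
From mathcomp Require Import ring lra zify.
Set Implicit Arguments.
Unset Strict Implicit.
Unset Printing Implicit Defensive.
Import Order.TTheory GRing.Theory Num.Theory.
Local Open Scope classical_set_scope.
Local Open Scope ring_scope.

(** * Euclidean inner product and Cauchy-Schwarz bounds *)

Section Dot.
Variable R : realType.
Implicit Types u v w : 'rV[R]_3.

Lemma dotE u v : dot u v = u 0 0 * v 0 0 + u 0 1 * v 0 1 + u 0 2 * v 0 2.
Proof.
rewrite /dot mxE !big_ord_recl big_ord0 !mxE addr0 addrA.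
have -> : lift ord0 (lift ord0 ord0) = 2 :> 'I_3 by exact/val_inj.
by have -> : lift ord0 ord0 = 1 :> 'I_3 by exact/val_inj.
Qed.

Lemma dotC u v : dot u v = dot v u.
Proof. by rewrite !dotE; ring. Qed.

Lemma dotDl u v w : dot (u + v) w = dot u w + dot v w.
Proof. by rewrite !dotE !mxE; ring. Qed.

Lemma dotDr u v w : dot u (v + w) = dot u v + dot u w.
Proof. by rewrite !(dotC u) dotDl. Qed.

Lemma dotZl a u v : dot (a *: u) v = a * dot u v.
Proof. by rewrite !dotE !mxE; ring. Qed.

Lemma dotZr a u v : dot u (a *: v) = a * dot u v.
Proof. by rewrite !(dotC u) dotZl. Qed.

Lemma dotNl u v : dot (- u) v = - dot u v.
Proof. by rewrite -scaleN1r dotZl mulN1r. Qed.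

Lemma dotNr u v : dot u (- v) = - dot u v.
Proof. by rewrite !(dotC u) dotNl. Qed.

Definition dot_lin := (dotDl, dotDr, dotNl, dotNr, dotZl, dotZr).

Lemma dot_ge0 u : 0 <= dot u u.
Proof. by rewrite dotE; nra. Qed.

Lemma dot_cauchy_schwarz u v : dot u v ^+ 2 <= dot u u * dot v v.
Proof.
rewrite !dotE.
set a := u 0 0; set b := u 0 1; set c := u 0 2.
set x := v 0 0; set y := v 0 1; set z := v 0 2.
rewrite -subr_ge0.
have -> : (a * a + b * b + c * c) * (x * x + y * y + z * z) -
    (a * x + b * y + c * z) ^+ 2 =
    (a * y - b * x) ^+ 2 + (a * z - c * x) ^+ 2 + (b * z - c * y) ^+ 2 by ring.
by rewrite !addr_ge0 ?sqr_ge0.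
Qed.

Lemma dot_ge_opp u v r s : 0 <= r -> 0 <= s ->
  dot u u <= r ^+ 2 -> dot v v <= s ^+ 2 -> - (r * s) <= dot u v.
Proof.
move=> r0 s0 ur vs.
suff : `|dot u v| <= r * s by rewrite ler_norml => /andP[].
rewrite -[_ <= _]ler_sqr ?nnegrE ?mulr_ge0 //= real_normK ?num_real // exprMn.
apply: le_trans (dot_cauchy_schwarz u v) _.
by apply: ler_pM => //; exact: dot_ge0.
Qed.

(** The bound on [u] is strict, as for a point of an open ball; the one on [v] is not, so that a
    unit normal with [s = 1] also fits. *)
Lemma dot_gt_opp u v r s : 0 < r -> 0 < s ->
  dot u u < r ^+ 2 -> dot v v <= s ^+ 2 -> - (r * s) < dot u v.
Proof.
move=> r0 s0 ur vs.
suff : `|dot u v| < r * s by rewrite ltr_norml => /andP[].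
rewrite -[_ < _]ltr_sqr ?nnegrE ?normr_ge0 ?(ltW (mulr_gt0 r0 s0)) //.
rewrite real_normK ?num_real // exprMn.
apply: le_lt_trans (dot_cauchy_schwarz u v) _.
apply: le_lt_trans (ler_wpM2l (dot_ge0 u) vs) _.
by rewrite ltr_pM2r // exprn_gt0.
Qed.

End Dot.

(** * The Lorentz form on inversive coordinates *)

Section Lorentz.
Variable R : realType.

(** Twice the inverse of [Q_W]. *)
Definition W_lorentz : 'M[R]_5 :=
  mx5 [:: [:: 0; - 2^-1; 0; 0; 0];
          [:: - 2^-1; 0; 0; 0; 0];
          [:: 0; 0; 1; 0; 0];
          [:: 0; 0; 0; 1; 0];
          [:: 0; 0; 0; 0; 1]].

Definition ip (u v : 'rV[R]_5) : R := (u *m W_lorentz *m v^T) 0 0.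

Lemma ip_row5 a b x y z a' b' x' y' z' :
  ip (row5 a b x y z) (row5 a' b' x' y' z') =
  x * x' + y * y' + z * z' - (a * b' + a' * b) / 2.
Proof.
rewrite /ip mxE !big_ord_recl big_ord0 !mxE.
rewrite !big_ord_recl !big_ord0 !mxE /=; ring.
Qed.

Lemma W_lorentz_sym : W_lorentz^T = W_lorentz.
Proof.
apply/matrixP=> -[i hi] [j hj]; rewrite !mxE /=.
by move: i j hi hj => [|[|[|[|[|i]]]]] [|[|[|[|[|j]]]]].
Qed.

Lemma Q_W_lorentz : Q_W R *m W_lorentz = 2%:M.
Proof.
apply/matrixP=> -[i hi] [j hj]; rewrite !mxE !big_ord_recl big_ord0 !mxE /=.
rewrite -val_eqE /=.
by move: i j hi hj => [|[|[|[|[|i]]]]] [|[|[|[|[|j]]]]] //= _ _;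
  rewrite ?mulr1n ?mulr0n; field.
Qed.

Lemma ipC u v : ip u v = ip v u.
Proof.
rewrite /ip -[in LHS](trmxK (u *m _)) -trmx_mul mxE trmx_mul W_lorentz_sym.
by rewrite mulmxA.
Qed.

Lemma ipDl u v w : ip (u + v) w = ip u w + ip v w.
Proof. by rewrite /ip !mulmxDl mxE. Qed.

Lemma ipZl a u w : ip (a *: u) w = a * ip u w.
Proof. by rewrite /ip -!scalemxAl mxE. Qed.

Lemma ipNl u w : ip (- u) w = - ip u w.
Proof. by rewrite -scaleN1r ipZl mulN1r. Qed.

Lemma ipDr u v w : ip u (v + w) = ip u v + ip u w.
Proof. by rewrite !(ipC u) ipDl. Qed.

Lemma ipZr a u w : ip u (a *: w) = a * ip u w.
Proof. by rewrite !(ipC u) ipZl. Qed.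

Lemma ipNr u w : ip u (- w) = - ip u w.
Proof. by rewrite !(ipC u) ipNl. Qed.

Definition ip_lin := (ipDl, ipDr, ipNl, ipNr, ipZl, ipZr).

Lemma gram_entry m n (A : 'M[R]_(m, 5)) (B : 'M[R]_(n, 5)) i j :
  (A *m W_lorentz *m B^T) i j = ip (row i A) (row j B).
Proof.
rewrite /ip -row_mul tr_row !mxE.
by apply: eq_bigr => k _; rewrite !mxE.
Qed.

End Lorentz.

(** * Lorentz products and the relative position of spheres *)

Section Geometry.
Variable R : realType.
Implicit Types (S T : osphere R) (c n : 'rV[R]_3).

(** The law of cosines: at a common point, this is the cosine of the angle between the normals
    pointing into the two regions. *)
Lemma ip_sphere_sphere c r (hr : r != 0) c' r' (hr' : r' != 0) :
  ip (inv_coords (Sphere c hr)) (inv_coords (Sphere c' hr')) =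
  (r ^+ 2 + r' ^+ 2 - dot (c - c') (c - c')) / (2 * r * r').
Proof. by rewrite /= ip_row5 !dotE !mxE; field; rewrite hr hr'. Qed.

Lemma ip_plane_sphere n h (hn : dot n n = 1) c r (hr : r != 0) :
  ip (inv_coords (Plane h hn)) (inv_coords (Sphere c hr)) = (dot n c - h) / r.
Proof. by rewrite /= ip_row5 !dotE; field. Qed.

Lemma ip_plane_plane n h (hn : dot n n = 1) n' h' (hn' : dot n' n' = 1) :
  ip (inv_coords (Plane h hn)) (inv_coords (Plane h' hn')) = dot n n'.
Proof. by rewrite /= ip_row5 !dotE; field. Qed.

Lemma ip_inv_coords S : ip (inv_coords S) (inv_coords S) = 1.
Proof.
case: S => [c r hr|n h hn]; last by rewrite ip_plane_plane.
by rewrite ip_sphere_sphere subrr dotE !mxE; field.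
Qed.

(** Supplies a distance to walk along a ray: short of the radius [r], yet past a threshold [x] that
    may be negative. *)
Lemma gt0_between (x r : R) : 0 < r -> x < r ->
  exists t, [/\ 0 < t, t < r & x < t].
Proof.
move=> r_gt0 lt_xr; have [x_le0|x_gt0] := leP x 0.
  by exists (r / 2); split; lra.
by exists ((x + r) / 2); split; lra.
Qed.

(** Ordering the radii leaves three cases: two exteriors, which share infinity; a ball and an
    exterior; two balls. *)
Lemma ip_gtN1_spheres_meet c r (hr : r != 0) c' r' (hr' : r' != 0) : r' <= r ->
  -1 < ip (inv_coords (Sphere c hr)) (inv_coords (Sphere c' hr')) ->
  region (Sphere c hr) `&` region (Sphere c' hr') !=set0.
Proof.
rewrite ip_sphere_sphere; set D := dot _ _ => le_r'r.
have [r_lt0|r_gt0|/eqP] := ltgtP r 0; last by rewrite (negbTE hr).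
  by move=> _; exists None; split=> //=; exact: le_lt_trans le_r'r r_lt0.
have [r'_lt0|r'_gt0|/eqP] := ltgtP r' 0; last by rewrite (negbTE hr').
- rewrite ltr_ndivlMr; last by nra.
  move=> hD; pose d := Num.sqrt D.
  have D_gt0 : 0 < D by have := sqr_ge0 (r + r'); lra.
  have d_gt0 : 0 < d by rewrite sqrtr_gt0.
  have dD : d ^+ 2 = D by rewrite sqr_sqrtr // ltW.
  have lt_d : - r' < d + r.
    by rewrite ltNge; apply/negP => le_d; nra.
  have [t [t_gt0 t_ltr t_d]] : exists t, [/\ 0 < t, t < r & - r' - d < t].
    by apply: gt0_between => //; lra.
  (* The point on the line of centres at distance [t] beyond [c] as seen from [c']: inside the first
     ball, and at distance [d + t] from [c']. *)
  exists (Some (c + (t / d) *: (c - c'))); split=> /=.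
    rewrite r_gt0 addrC addKr !dotZl !dotZr -/D -dD.
    have -> : t / d * (t / d * d ^+ 2) = t ^+ 2 by field; rewrite gt_eqF.
    by nra.
  rewrite ltNge (ltW r'_lt0) /=.
  have -> : c + (t / d) *: (c - c') - c' = (1 + t / d) *: (c - c').
    by rewrite scalerDl scale1r addrAC.
  rewrite !dotZl !dotZr -/D -dD.
  have -> : (1 + t / d) * ((1 + t / d) * d ^+ 2) = (d + t) ^+ 2.
    by field; rewrite gt_eqF.
  by nra.
- rewrite ltr_pdivlMr; last by nra.
  move=> hD; have rr'_gt0 : 0 < r + r' by lra.
  have lt_D : D < (r + r') ^+ 2 by nra.
  have sc s : 0 < s -> s / (r + r') * (s / (r + r') * D) < s ^+ 2.
    move=> s_gt0; rewrite mulrA -expr2 exprMn -mulrA gtr_pMr ?exprn_gt0 //.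
    by rewrite mulrC exprVn ltr_pdivrMr ?mul1r ?exprn_gt0.
  (* The point dividing the segment of centres in the ratio [r : r']. *)
  exists (Some (c - (r / (r + r')) *: (c - c'))); split=> /=.
    rewrite r_gt0 addrC addKr dotNl dotNr opprK !dotZl !dotZr; exact: sc.
  rewrite r'_gt0.
  have -> : c - (r / (r + r')) *: (c - c') - c' = (r' / (r + r')) *: (c - c').
    have -> : r' / (r + r') = 1 - r / (r + r') by field; rewrite gt_eqF.
    by rewrite scalerBl scale1r addrAC.
  rewrite !dotZl !dotZr; exact: sc.
Qed.

Lemma ip_gtN1_plane_sphere_meet n h (hn : dot n n = 1) c r (hr : r != 0) :
  -1 < ip (inv_coords (Plane h hn)) (inv_coords (Sphere c hr)) ->
  region (Plane h hn) `&` region (Sphere c hr) !=set0.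
Proof.
rewrite ip_plane_sphere.
have in_ray t : 0 < r -> h < dot n c + t -> 0 <= t < r ->
    region (Plane h hn) `&` region (Sphere c hr) !=set0.
  move=> r_gt0 ht t_r; exists (Some (c + t *: n)); split=> /=.
    by rewrite dotDr dotZr hn mulr1.
  by rewrite r_gt0 addrC addKr dotZl dotZr hn mulr1; nra.
have [r_lt0|r_gt0|/eqP] := ltgtP r 0; last by rewrite (negbTE hr).
  (* As [r] is negative, this [t] exceeds both [h - dot n c] and the absolute value of [r]. *)
  move=> _; pose t := `|h - dot n c| + 1 - r.
  have := ler_norm (h - dot n c); have := normr_ge0 (h - dot n c).
  move=> n_ge0 n_ge.
  exists (Some (c + t *: n)); split=> /=.
    by rewrite dotDr dotZr hn /t; lra.
  rewrite ltNge (ltW r_lt0) /= addrC addKr dotZl dotZr hn mulr1 /t; nra.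
rewrite ltr_pdivlMr // => lt_h.
have [//||t [t_gt0 t_ltr lt_t]] := @gt0_between (h - dot n c) r; first lra.
by apply: (in_ray t) => //; lra.
Qed.

Lemma ip_gtN1_planes_meet n h (hn : dot n n = 1) n' h' (hn' : dot n' n' = 1) :
  -1 < ip (inv_coords (Plane h hn)) (inv_coords (Plane h' hn')) ->
  region (Plane h hn) `&` region (Plane h' hn') !=set0.
Proof.
rewrite ip_plane_plane => lt_ip.
have q_neq0 : 1 + dot n n' != 0 by rewrite gt_eqF //; lra.
(* Both normals have product [1 + dot n n'] with [n + n'], so at [t *: (n + n')] both linear forms
   take one value, larger than [h] and [h']. *)
pose t := (`|h| + `|h'| + 1) / (1 + dot n n').
have tE : t * (1 + dot n n') = `|h| + `|h'| + 1 by rewrite divfK.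
have := ler_norm h; have := ler_norm h'.
have := normr_ge0 h; have := normr_ge0 h' => *.
exists (Some (t *: (n + n'))); split=> /=; rewrite dotZr dotDr.
  by rewrite hn tE; lra.
by rewrite hn' dotC addrC tE; lra.
Qed.

Lemma disjoint_regions_ip S T :
  region S `&` region T = set0 -> ip (inv_coords S) (inv_coords T) <= -1.
Proof.
move=> disj; rewrite leNgt; apply/negP=> lt_ip.
suff : region S `&` region T !=set0 by rewrite disj => -[].
move: lt_ip; case: S T {disj} => [c r hr|n h hn] [c' r' hr'|n' h' hn'] lt_ip.
- have [le_r|/ltW le_r] := leP r' r; first exact: ip_gtN1_spheres_meet.
  by rewrite setIC; apply: ip_gtN1_spheres_meet; rewrite // ipC.
- by rewrite setIC; apply: ip_gtN1_plane_sphere_meet; rewrite ipC.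
- exact: ip_gtN1_plane_sphere_meet.
- exact: ip_gtN1_planes_meet.
Qed.

(* At a common point the unit normals of the two spheres have product [ip]. *)
Lemma carriers_meet_ip S T :
  carrier S `&` carrier T !=set0 -> -1 <= ip (inv_coords S) (inv_coords T).
Proof.
have CS n n' : dot n n = 1 -> dot n' n' = 1 -> -1 <= dot n n'.
  move=> hn hn'; have := @dot_ge_opp _ n n' 1 1.
  by rewrite hn hn' expr1n mulr1; apply.
(* The factor [- r^-1] makes the normal point into the region for either sign of [r]. *)
have unit_normal (c x : 'rV[R]_3) r :
    r != 0 -> dot (x - c) (x - c) = r ^+ 2 ->
    dot (- r^-1 *: (x - c)) (- r^-1 *: (x - c)) = 1.
  by move=> r0 e; rewrite dotZl dotZr e; field.
have plane_sphere n h (hn : dot n n = 1) c r (hr : r != 0) :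
    carrier (Plane h hn) `&` carrier (Sphere c hr) !=set0 ->
    -1 <= ip (inv_coords (Plane h hn)) (inv_coords (Sphere c hr)).
  rewrite ip_plane_sphere => -[[x|] [] //= xS xT]; rewrite -xS.
  have -> : (dot n c - dot n x) / r = dot n (- r^-1 *: (x - c)).
    by rewrite dotZr dotDr dotNr; field.
  by apply: CS => //; exact: unit_normal.
case: S T => [c r hr|n h hn] [c' r' hr'|n' h' hn'] meet.
- rewrite ip_sphere_sphere; case: meet => -[x|] [] //= xS xT; rewrite -xS -xT.
  have -> : c - c' = (x - c') - (x - c) by rewrite opprB [RHS]addrC addrA subrK.
  move: (CS _ _ (unit_normal _ _ _ hr xS) (unit_normal _ _ _ hr' xT)).
  rewrite dotZl dotZr => /le_trans; apply; rewrite le_eqVlt; apply/orP; left.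
  apply/eqP; rewrite !dot_lin (dotC x c) (dotC x c') (dotC c' c).
  by field; rewrite hr hr'.
- by rewrite ipC; apply: plane_sphere; rewrite setIC.
- exact: plane_sphere.
- by rewrite ip_plane_plane; exact: CS.
Qed.

(** Negating both vectors keeps [ip] but passes to the opposite regions, hence the sign conditions:
    nonnegative bends exclude exteriors, and for parallel planes with opposite normals the third
    condition makes the half-spaces face away from each other. *)
Lemma ip_leN1_disjoint S T :
  0 <= inv_coords S 0 1 -> 0 <= inv_coords T 0 1 ->
  0 <= inv_coords S 0 0 + inv_coords T 0 0 ->
  ip (inv_coords S) (inv_coords T) <= -1 -> region S `&` region T = set0.
Proof.
have bend_gt0 (r : R) : r != 0 -> 0 <= r^-1 -> 0 < r.
  by move=> r0; rewrite invr_ge0 lt_neqAle eq_sym r0.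
have plane_sphere n h (hn : dot n n = 1) c r (hr : r != 0) : 0 < r ->
    ip (inv_coords (Plane h hn)) (inv_coords (Sphere c hr)) <= -1 ->
    region (Plane h hn) `&` region (Sphere c hr) = set0.
  rewrite ip_plane_sphere => r_gt0; rewrite ler_pdivrMr // => le_ip.
  apply/seteqP; split=> // -[x|] [] //=; rewrite r_gt0 => xS xT.
  have := @dot_gt_opp _ (x - c) (- n) r 1 r_gt0 ltr01 xT.
  rewrite dotNl dotNr opprK hn expr1n dotDl !dotNr dotNl (dotC x) (dotC c).
  by move=> /(_ (lexx 1)); lra.
case: S T => [c r hr|n h hn] [c' r' hr'|n' h' hn'].
- rewrite ip_sphere_sphere !mxE /= => /(bend_gt0 _ hr) r_gt0.
  move=> /(bend_gt0 _ hr') r'_gt0 _; rewrite ler_pdivrMr; last by nra.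
  move=> le_ip; apply/seteqP; split=> // -[x|] [] /=; last by lra.
  rewrite r_gt0 r'_gt0 => xS xT.
  have := dot_gt_opp r_gt0 r'_gt0 xS (ltW xT).
  (* A common point would make the squared distance of the centres smaller than [(r + r') ^+ 2],
     against [le_ip]. *)
  have DE : dot (c - c') (c - c') = dot (x - c) (x - c)
      + dot (x - c') (x - c') - 2 * dot (x - c) (x - c').
    by rewrite !dotE !mxE; ring.
  by move: le_ip; rewrite DE; lra.
- rewrite setIC ipC => bS _ _; apply: plane_sphere.
  by move: bS; rewrite !mxE; exact: bend_gt0.
- move=> _ bT _; apply: plane_sphere.
  by move: bT; rewrite !mxE; exact: bend_gt0.
- rewrite ip_plane_plane !mxE /= => _ _ h_ge0 le_ip.
  apply/seteqP; split=> // -[x|] [] //= xS xT.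
  (* Here [n + n'] has square at most 0, so its product with [x] vanishes, although [xS] and [xT]
     make that product exceed [h + h']. *)
  have := dot_cauchy_schwarz (n + n') x.
  have -> : dot (n + n') (n + n') = 2 + 2 * dot n n'.
    by rewrite !dot_lin hn hn' (dotC n' n); ring.
  rewrite dotDl; have := dot_ge0 x; move=> *; nra.
Qed.

(** * The standard configuration and its images *)

Lemma std_coords_ge0 (i : 'I_8) :
  0 <= std_coords R i 0 0 /\ 0 <= std_coords R i 0 1.
Proof.
case: i => i hi; rewrite /std_coords /=.
by move: i hi => [|[|[|[|[|[|[|[|i]]]]]]]] //= _; rewrite !mxE /=; lra.
Qed.

(** The products are -1 for tangent pairs and -3 for the opposite ones. *)
Lemma std_coords_ip (i j : 'I_8) : i != j ->
  ip (std_coords R i) (std_coords R j) <= -1.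
Proof.
have s2 : Num.sqrt 2 * Num.sqrt 2 = 2 :> R by rewrite -expr2 sqr_sqrtr.
case: i j => i hi [j hj]; rewrite -val_eqE /std_coords /=.
by move: i j hi hj => [|[|[|[|[|[|[|[|i]]]]]]]] [|[|[|[|[|[|[|[|j]]]]]]]] //=
  _ _ _; rewrite ip_row5 ?mulrN ?mulNr ?s2; lra.
Qed.

(** Injective maps preserve disjointness, so it suffices to check the standard regions, where the
    coordinates have the required signs and products. *)
Lemma orthoplicial_regions_disjoint (V : 'I_8 -> osphere R) (i j : 'I_8) :
  orthoplicial_platonic V -> i != j -> region (V i) `&` region (V j) = set0.
Proof.
move=> [V0 [f [s [stdV [/bij_inj f_inj _] fV]]]] ne_ij.
rewrite (fV i).2 (fV j).2.
have : region (V0 (s i)) `&` region (V0 (s j)) = set0.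
  have [ai bi] := std_coords_ge0 (s i); have [aj bj] := std_coords_ge0 (s j).
  apply: ip_leN1_disjoint; rewrite ?stdV ?addr_ge0 //.
  by apply: std_coords_ip; rewrite (inj_eq perm_inj).
move=> disj; apply/seteqP; split=> // y [[p pi <-] [q qj /f_inj eqp]].
have : (region (V0 (s i)) `&` region (V0 (s j))) p by split; rewrite // -eqp.
by rewrite disj.
Qed.

Lemma orthoplicial_ip_le (V : 'I_8 -> osphere R) (i j : 'I_8) :
  orthoplicial_platonic V -> i != j ->
  ip (inv_coords (V i)) (inv_coords (V j)) <= -1.
Proof.
by move=> hV ij; apply/disjoint_regions_ip/orthoplicial_regions_disjoint.
Qed.

Lemma orthoplicial_ip_tangent (V : 'I_8 -> osphere R) (i j : 'I_8) :
  orthoplicial_platonic V -> admissible V -> i != j %[mod 4] ->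
  ip (inv_coords (V i)) (inv_coords (V j)) = -1.
Proof.
move=> hV hadm ij4.
have ij : i != j by apply: contraNneq ij4 => ->.
apply/eqP; rewrite eq_le orthoplicial_ip_le //=.
have := hadm i j ij; rewrite (negbTE ij4) => -[p tan_p].
by apply: carriers_meet_ip; rewrite tan_p; exists p.
Qed.

End Geometry.

(** * The Gram matrix of the F-matrix and its inversion *)

Section GramMatrix.
Variable R : realType.

(** The product of [B] with [W_lorentz R *m C^T] is an invertible diagonal matrix, so the latter
    factor is invertible and has no nonzero left kernel. *)
Lemma ip_nondegenerate (B C : 'M[R]_5) (e D : 'rV[R]_5) :
  (forall i j, ip (row i B) (row j C) = (D 0 i) *+ (i == j)) ->
  (forall i, D 0 i != 0) -> (forall i, ip e (row i C) = 0) -> e = 0.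
Proof.
move=> BC D_neq0 eC.
have BCE : B *m (W_lorentz R *m C^T) = diag_mx D.
  by apply/matrixP=> i j; rewrite mulmxA gram_entry BC mxE eq_sym.
have : W_lorentz R *m C^T \in unitmx.
  have : diag_mx D \in unitmx.
    by rewrite unitmxE det_diag unitfE; apply/prodf_neq0.
  by rewrite -BCE unitmx_mul => /andP[].
move=> u; apply: (can_inj (mulmxK u)); rewrite mul0mx mulmxA.
apply/matrixP=> i j; rewrite gram_entry [RHS]mxE -(eC j).
by congr ip; apply/rowP=> k; rewrite mxE ord1.
Qed.

Lemma antipodal_sums_eq (v : nat -> 'rV[R]_5) :
  (forall i j, (i < 8)%N -> (j < 8)%N -> (i %% 4 != j %% 4)%N ->
     ip (v i) (v j) = -1) ->
  (forall i, (i < 8)%N -> ip (v i) (v i) = 1) ->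
  (forall i, (i < 4)%N -> ip (v i) (v (i + 4)%N) <= -1) ->
  v 0%N + v 4%N = v 1%N + v 5%N.
Proof.
move=> v_tan v_unit v_opp.
pose m i := v i + v (i + 4)%N; pose d i := v i - v (i + 4)%N.
have mm i j : (i < 4)%N -> (j < 4)%N -> i != j -> ip (m i) (m j) = -4.
  move=> i4 j4 ij; rewrite /m !ip_lin !v_tan; lia || lra.
have dm i j : (i < 4)%N -> (j < 4)%N -> ip (d i) (m j) = 0.
  move=> i4 j4; have [<-|ij] := eqVneq i j.
    rewrite /m /d !ip_lin (ipC (v (i + 4)%N)) !v_unit; lia || lra.
  by rewrite /m /d !ip_lin !v_tan; lia || lra.
have dd i j : (i < 4)%N -> (j < 4)%N -> i != j -> ip (d i) (d j) = 0.
  by move=> i4 j4 ij; rewrite /d !ip_lin !v_tan; lia || lra.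
(* The square is 2 minus twice the product of the opposite pair, hence at least 4. *)
have dd_gt0 i : (i < 4)%N -> 0 < ip (d i) (d i).
  move=> i4; have := v_opp i i4.
  by rewrite /d !ip_lin (ipC (v (i + 4)%N)) !v_unit; lia || lra.
(* The last rows of [B] and [C] differ because [m 2] and [m 3] have the known product -4, while the
   square of a single sum involves the unknown product of an opposite pair. *)
pose B : 'M[R]_5 := \matrix_(i < 5) if (i < 4)%N then d i else m 2%N.
pose C : 'M[R]_5 := \matrix_(i < 5) if (i < 4)%N then d i else m 3%N.
pose D : 'rV[R]_5 := \row_i if (i < 4)%N then ip (d i) (d i) else -4.
apply/eqP; rewrite -subr_eq0; apply/eqP; apply: (@ip_nondegenerate B C _ D).
- move=> i j; rewrite !rowK mxE.
  case: (ltnP i 4) => i4; case: (ltnP j 4) => j4.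
  + by have [->|ij] := eqVneq i j; [|rewrite dd].
  + by rewrite dm // -val_eqE /= (ltn_eqF (leq_trans i4 j4)).
  + by rewrite ipC dm // -val_eqE /= (gtn_eqF (leq_trans j4 i4)).
  + have -> : i = j.
      by apply: val_inj => /=; have := ltn_ord i; have := ltn_ord j; lia.
    by rewrite mm // eqxx.
- move=> i; rewrite mxE; case: ltnP => i4; first by rewrite gt_eqF ?dd_gt0.
  by rewrite oppr_eq0.
(* The vector [m 0 - m 1] is orthogonal to every [d i], and to [m 3] because both its terms have
   product -4 with it. *)
- move=> i; rewrite rowK -/(m 0%N) -/(m 1%N) ipDl ipNl.
  case: ltnP => i4; last by rewrite !mm // subrr.
  by rewrite !(ipC _ (d i)) !dm // subrr.
Qed.

(** Substituting [G] gives a product of square matrices ending in [F^T] and equal to 2 times the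
    identity. One-sided inverses being two-sided, [F^T] moves to the front; then the form and [Q_W]
    are both twice the inverse of [W_lorentz]. *)
Lemma gram_to_form (F G : 'M[R]_5) : F *m W_lorentz R *m F^T = G ->
  Q_F R *m G = 2%:M -> F^T *m Q_F R *m F = Q_W R.
Proof.
move=> FG QG; have n2 : 2 != 0 :> R by [].
have two_inv (A B : 'M[R]_5) : A *m B = 2%:M -> (2^-1 *: A) *m B = 1%:M.
  by move=> AB; rewrite -scalemxAl AB scale_scalar_mx mulVf.
have /two_inv/mulmx1C FW : F^T *m Q_F R *m F *m W_lorentz R = 2%:M.
  have : Q_F R *m F *m W_lorentz R *m F^T = 2%:M by rewrite -QG -FG !mulmxA.
  move=> /two_inv; rewrite scalemxAl => /mulmx1C.
  rewrite -!scalemxAl -!scalemxAr !mulmxA => /(congr1 ( *:%R 2)); rewrite scalerA mulfV // scale1r.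
  by rewrite scale_scalar_mx mulr1.
have WQ : W_lorentz R *m (2^-1 *: Q_W R) = 1%:M.
  exact/mulmx1C/two_inv/Q_W_lorentz.
have : 2^-1 *: (F^T *m Q_F R *m F) = 2^-1 *: Q_W R.
  by rewrite -[LHS]mulmx1 -WQ mulmxA (mulmx1C FW) mul1mx.
by move=> /(congr1 ( *:%R 2)); rewrite !scalerA mulfV // !scale1r.
Qed.

(** All entries of the Gram matrix are -1, except the first four diagonal ones, which are 1. *)
Lemma F_matrix_gram (V : 'I_8 -> osphere R) :
  orthoplicial_platonic V -> admissible V ->
  Q_F R *m (F_matrix V *m W_lorentz R *m (F_matrix V)^T) = 2%:M.
Proof.
move=> hV hadm; pose v k := inv_coords (V (inord k)).
have v_tan i j : (i < 8)%N -> (j < 8)%N -> (i %% 4 != j %% 4)%N ->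
    ip (v i) (v j) = -1.
  by move=> i8 j8 ij; apply: orthoplicial_ip_tangent; rewrite // !inordK.
have v_unit i : ip (v i) (v i) = 1 by exact: ip_inv_coords.
have v_opp i : (i < 4)%N -> ip (v i) (v (i + 4)%N) <= -1.
  move=> i4; apply: orthoplicial_ip_le => //.
  by rewrite -val_eqE /= !inordK; lia.
have m_eq := antipodal_sums_eq v_tan (fun i _ => v_unit i) v_opp.
pose mu := antipodal_vector V.
(* With two expressions of [mu], each product below can be expanded over tangent pairs alone, so the
   products of opposite spheres never enter. *)
have mu0 : mu = 2^-1 *: (v 0%N + v 4%N) by [].
have mu1 : mu = 2^-1 *: (v 1%N + v 5%N) by rewrite -m_eq.
have v_mu i : (i < 4)%N -> ip (v i) mu = -1.
  by case: i => [|i] i4; [rewrite mu1|rewrite mu0];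
    rewrite !ip_lin !v_tan; lia || lra.
have mu_mu : ip mu mu = -1 by rewrite {1}mu0 mu1 !ip_lin !v_tan //; lra.
have rowF (i : 'I_5) : row i (F_matrix V) = if (i < 4)%N then v i else mu.
  by rewrite rowK.
apply/matrixP => i j; rewrite !mxE !big_ord_recl big_ord0 !gram_entry !rowF.
rewrite !mxE /= -val_eqE /=; case: i j => i hi [j hj] /=.
by move: i j hi hj => [|[|[|[|[|i]]]]] [|[|[|[|[|j]]]]] //= _ _;
  rewrite /bump ?(ipC mu) ?v_mu ?mu_mu ?v_unit ?v_tan // ?mulr1n ?mulr0n; lra.
Qed.

Lemma descartes_form_col (A : 'M[R]_5) i :
  descartes_form (col i A) = (A^T *m Q_F R *m A) i i.
Proof.
rewrite /descartes_form tr_col -row_mul !mxE.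
by apply: eq_bigr => k _; rewrite !mxE.
Qed.

End GramMatrix.

Theorem theorem3p8 (R : realType) (V : 'I_8 -> osphere R)
    (hV : orthoplicial_platonic V) (hadm : admissible V) :
  (F_matrix V)^T *m Q_F R *m F_matrix V = Q_W R /\
  [/\ descartes_form (col (inord 0) (F_matrix V)) = 0,
      descartes_form (col (inord 1) (F_matrix V)) = 0,
      descartes_form (col (inord 2) (F_matrix V)) = 2,
      descartes_form (col (inord 3) (F_matrix V)) = 2 &
      descartes_form (col (inord 4) (F_matrix V)) = 2].
Proof.
have FQF := gram_to_form (erefl _) (F_matrix_gram hV hadm).
by split=> //; split; rewrite descartes_form_col FQF mxE inordK.
Qed.
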